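(* Let $r>2$ and let $p$ be an odd prime which does not divide $r-2$. Let $N=\mathbb{Z}_p^r$ (row vectors) and define $\sigma,\varphi_1,\dots,\varphi_r\in\mathrm{GL}_r(p)$ as follows: $\sigma$ is the permutation matrix of order $r$ with entries $1$ in positions $(i,i+1)$ for $1\le i\le r-1$ and in position $(r,1)$, and $0$ elsewhere; and for $1\le i\le r$, $\varphi_i$ is the diagonal matrix with $-1$ in the $(i,i)$ entry and $1$ in all remaining diagonal entries. Let $S:=\langle\varphi_1,\dots,\varphi_r\rangle\cong\mathbb{Z}_2^r$, and $G:=(N\rtimes S)\rtimes\langle\sigma\rangle$, with $\langle S,\sigma\rangle$ acting on $N$ by right multiplication. Let $n:=(0,\dots,0,1)\in N$, $g:=n\sigma\in G$, and $\Gamma:=\mathrm{Cos}(G,S,g)$. Then $(\Gamma,G)\in\mathcal{OG}(4)$, and $(\Gamma,G)$ is basic of oriented-cycle type. Moreover, $G$ has a unique minimal normal subgroup $N$ isomorphic to $\mathbb{Z}_p^r$, and $\Gamma_N\cong\mathbf{C}_r$.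
   Context: All groups and graphs are finite; graphs are simple and undirected. For a group $G$, a proper subgroup $S<G$ and $g\in G\setminus S$, the coset graph $\mathrm{Cos}(G,S,g)$ has vertex set $\{Sx: x\in G\}$, with $\{Sx,Sy\}$ an edge iff $xy^{-1}\in SgS$ or $yx^{-1}\in SgS$; $G$ acts on it by right multiplication, and $(\Gamma,G)$ refers to this action (so $(\Gamma,G)\in\mathcal{OG}(4)$ includes that the action is faithful). In $G$, conjugation satisfies $v^{x}=x^{-1}vx=$ the row vector $v\in N$ multiplied on the right by the matrix $x\in\langle S,\sigma\rangle$; also $\varphi_i^\sigma=\varphi_{i+1}$ with $\varphi_r^\sigma=\varphi_1$, so $G/N\cong\langle S,\sigma\rangle\cong\mathbb{Z}_2^r\rtimes\mathbb{Z}_r$. For $G\le \mathrm{Aut}(\Gamma)$, $\Gamma$ is $G$-oriented if $G$ is transitive on the vertices and on the edges of $\Gamma$ but not on the arcs (ordered pairs of adjacent vertices). $\mathcal{OG}(4)$ is the set of pairs $(\Gamma,G)$ with $\Gamma$ a connected $4$-valent graph, $G\leq \mathrm{Aut}(\Gamma)$, and $\Gamma$ $G$-oriented. For $N\unlhd G$, the $G$-normal quotient $\Gamma_N$ is the graph whose vertices are the $N$-orbits on $V\Gamma$, two distinct $N$-orbits being adjacent iff there is an edge of $\Gamma$ between a vertex of one and a vertex of the other. $\tilde N$ denotes the kernel of the action of $G$ on the set of $N$-orbits. $\mathbf{C}_r$ ($r\ge 3$) is the cycle graph with $r$ vertices. $(\Gamma,G)\in\mathcal{OG}(4)$ is basic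 if $\Gamma_N$ is isomorphic to $K_1$, $K_2$ or some $\mathbf{C}_m$ ($m\geq 3$) for every nontrivial normal subgroup $N$ of $G$. A cyclic normal quotient is a $\Gamma_N$ isomorphic to some $\mathbf{C}_m$, $m\ge3$; it is $G$-oriented if $G/\tilde N\cong C_m$ (cyclic of order $m$) and $G$-unoriented if $G/\tilde N\cong D_m$ (dihedral of order $2m$). Two cyclic normal quotients $\Gamma_M,\Gamma_N$ are independent if $\Gamma_K$, with $K=\tilde M\cap\tilde N$, is not a cycle. $(\Gamma,G)$ is basic of oriented-cycle type if it is basic, has at least one cyclic normal quotient, has no independent cyclic normal quotients, and all its cyclic normal quotients are $G$-oriented. *)

(* Defs.v *)
From HB Require Import structures.
From mathcomp Require Import all_boot all_order all_fingroup all_algebra.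
From mathcomp Require Import all_solvable all_field all_character.

Set Implicit Arguments.
Unset Strict Implicit.
Unset Printing Implicit Defensive.

Import GroupScope GRing.Theory.

(* A graph has a finite vertex set inside an ambient finite type, so that       *)
(* coset graphs and normal quotients have honest sets of sets as vertices.      *)
Record sgraph (T : finType) := SGraph {
  vset : {set T};
  adj : rel T;
  adj_sym : symmetric adj;
  adj_irr : irreflexive adj;
  adj_vset : forall x y, adj x y -> x \in vset }.

Definition edges (T : finType) (Gam : sgraph T) : {set {set T}} :=
  [set [set xy.1; xy.2] | xy : T * T & adj Gam xy.1 xy.2].

Definition graph_iso (T U : finType) (Gam : sgraph T) (Del : sgraph U) : Prop :=
  exists f : T -> U,
    [/\ {in vset Gam &, injective f},
        f @: vset Gam = vset Del
      & {in vset Gam &, forall x y, adj Del (f x) (f y) = adj Gam x y}].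

Section StandardGraphs.

Variable m : nat.

Definition complete_adj : rel 'I_m := fun i j => i != j.

Fact complete_sym : symmetric complete_adj.
Proof. by move=> i j; rewrite /complete_adj eq_sym. Qed.

Fact complete_irr : irreflexive complete_adj.
Proof. by move=> i; rewrite /complete_adj eqxx. Qed.

Fact complete_vset i j : complete_adj i j -> i \in setT.
Proof. by []. Qed.

Definition complete_graph := SGraph complete_sym complete_irr complete_vset.

(* ordS is the cyclic successor i.+1 %% m; the condition i != j only matters    *)
(* for the degenerate value m = 1 (cycles are only ever used with 2 < m).       *)
Definition cycle_adj : rel 'I_m :=
  fun i j => (i != j) && ((j == ordS i) || (i == ordS j)).

Fact cycle_sym : symmetric cycle_adj.
Proof. by move=> i j; rewrite /cycle_adj eq_sym orbC. Qed.

Fact cycle_irr : irreflexive cycle_adj.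
Proof. by move=> i; rewrite /cycle_adj eqxx. Qed.

Fact cycle_vset i j : cycle_adj i j -> i \in setT.
Proof. by []. Qed.

Definition cycle_graph := SGraph cycle_sym cycle_irr cycle_vset.

End StandardGraphs.

Definition is_cycle (T : finType) (Gam : sgraph T) : Prop :=
  exists2 m, 2 < m & graph_iso Gam (cycle_graph m).

Section CosetGraph.

Variables (gT : finGroupType) (G S : {group gT}) (g : gT).
Hypothesis gGS : g \in G :\: S.

Definition cos_adj : rel {set gT} := fun X Y =>
  [exists x in G, exists y in G,
    [&& X == S :* x, Y == S :* y
      & (x * y^-1 \in S :* g * S) || (y * x^-1 \in S :* g * S)]].

Fact cos_sym : symmetric cos_adj.
Proof.
suff cs X Y : cos_adj X Y -> cos_adj Y X by move=> X Y; apply/idP/idP; apply: cs.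
case/exists_inP=> x Gx /exists_inP[y Gy /and3P[eX eY eg]].
apply/exists_inP; exists y => //; apply/exists_inP; exists x => //.
by rewrite eX eY orbC.
Qed.

Fact cos_irr : irreflexive cos_adj.
Proof.
move=> X; apply/exists_inP=> -[x Gx /exists_inP[y Gy /and3P[/eqP-> eY]]].
have /setDP[_ nSg] := gGS.
have Sxy : x * y^-1 \in S by rewrite -mem_rcoset -(eqP eY) rcoset_refl.
have Syx : y * x^-1 \in S by rewrite -groupV invMg invgK.
have nS u : u \in S :* g * S -> u \notin S.
  case/mulsgP=> _ t /rcosetP[s Ss ->] St ->.
  by rewrite groupMr // groupMl.
by case/orP=> /nS; rewrite ?Sxy ?Syx.
Qed.

Fact cos_vset X Y : cos_adj X Y -> X \in rcosets S G.
Proof.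
case/exists_inP=> x Gx /exists_inP[y Gy /and3P[/eqP-> _ _]].
by apply/rcosetsP; exists x.
Qed.

(* Cos(G, S, g); G acts on it by right multiplication through the action 'Rs.   *)
Definition coset_graph := SGraph cos_sym cos_irr cos_vset.

End CosetGraph.

Section OrientedGraphs.

Variables (aT : finGroupType) (T : finType).
Implicit Types (G N M K : {group aT}) (to : {action aT &-> T}) (Gam : sgraph T).

Definition acts_as_aut G to Gam : Prop :=
  [/\ [acts G, on vset Gam | to],
      [faithful G, on vset Gam | to]
    & {in G, forall a x y, adj Gam (to x a) (to y a) = adj Gam x y}].

Definition arc_transitive G to Gam : Prop :=
  forall x y u v, adj Gam x y -> adj Gam u v ->
    exists2 a, a \in G & to x a = u /\ to y a = v.

Definition oriented G to Gam : Prop :=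
  [/\ [transitive G, on vset Gam | to],
      [transitive G, on edges Gam | to^*]
    & ~ arc_transitive G to Gam].

Definition connected Gam : Prop :=
  {in vset Gam &, forall x y, connect (adj Gam) x y}.

Definition valent (k : nat) Gam : Prop :=
  {in vset Gam, forall x, #|[set y | adj Gam x y]| = k}.

Definition OG4 G to Gam : Prop :=
  [/\ connected Gam, valent 4 Gam, acts_as_aut G to Gam & oriented G to Gam].

Section NormalQuotient.

Variables (to : {action aT &-> T}) (Gam : sgraph T) (N : {set aT}).

Definition nq_vset : {set {set T}} := [set orbit to N x | x in vset Gam].

Definition nq_adj : rel {set T} := fun A B =>
  [&& A \in nq_vset, B \in nq_vset, A != B
    & [exists x in A, exists y in B, adj Gam x y]].

Fact nq_sym : symmetric nq_adj.
Proof.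
suff cs A B : nq_adj A B -> nq_adj B A by move=> A B; apply/idP/idP; apply: cs.
case/and4P=> VA VB nAB /exists_inP[x Ax /exists_inP[y By xy]].
rewrite /nq_adj VA VB eq_sym nAB; apply/exists_inP; exists y => //.
by apply/exists_inP; exists x; rewrite // adj_sym.
Qed.

Fact nq_irr : irreflexive nq_adj.
Proof. by move=> A; rewrite /nq_adj eqxx !andbF. Qed.

Fact nq_adj_vset A B : nq_adj A B -> A \in nq_vset.
Proof. by case/and4P. Qed.

Definition normal_quotient := SGraph nq_sym nq_irr nq_adj_vset.

End NormalQuotient.

(* The pointwise stabiliser in G of the set of N-orbits, a normal subgroup of G *)
(* as soon as N <| G and G acts on vset Gam.                                    *)
Definition nq_ker G to Gam (N : {set aT}) : {group aT} :=
  'C_G(nq_vset to Gam N | to^*)%G.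

Definition basic G to Gam : Prop :=
  OG4 G to Gam /\
  forall N, N <| G -> N :!=: 1 ->
    [\/ graph_iso (normal_quotient to Gam N) (complete_graph 1),
        graph_iso (normal_quotient to Gam N) (complete_graph 2)
      | is_cycle (normal_quotient to Gam N)].

Definition cyclic_quotient G to Gam N : Prop :=
  N <| G /\ is_cycle (normal_quotient to Gam N).

(* G / nq_ker is cyclic of order m, the number of vertices of the quotient.     *)
Definition oriented_quotient G to Gam N : Prop :=
  exists m, [/\ 2 < m, graph_iso (normal_quotient to Gam N) (cycle_graph m),
    cyclic (G / nq_ker G to Gam N) & #|G / nq_ker G to Gam N| = m].

Definition independent_quotients G to Gam M N : Prop :=
  ~ is_cycle (normal_quotient to Gam (nq_ker G to Gam M :&: nq_ker G to Gam N)).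

Definition basic_oriented_cycle_type G to Gam : Prop :=
  [/\ basic G to Gam,
      exists N, cyclic_quotient G to Gam N,
      forall M N, cyclic_quotient G to Gam M -> cyclic_quotient G to Gam N ->
        ~ independent_quotients G to Gam M N
    & forall N, cyclic_quotient G to Gam N -> oriented_quotient G to Gam N].

End OrientedGraphs.

Definition minimal_normal (gT : finGroupType) (M G : {group gT}) : bool :=
  [min M of H | H <| G & H :!=: 1].

Section Construction.

Variables r p : nat.

(* MathComp matrix groups have nonzero dimension by construction: {'GL_r[F]}    *)
(* consists of matrices of dimension r.-1.+1, which is r for all 0 < r.         *)
(* Indices are shifted by one: 0, ..., r - 1 instead of 1, ..., r.              *)
Local Notation d := r.-1.+1.
Local Notation F := 'F_p.

(* perm_mx s has its entries 1 at the positions (i, s i).                       *)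
Definition sigma_mx : 'M[F]_d := perm_mx (perm (@ordS_inj d)).

Definition phi_mx (i : 'I_d) : 'M[F]_d :=
  diag_mx (\row_j (if j == i then - 1 else 1)%R).

Fact sigma_unit : sigma_mx \in unitmx.
Proof. exact: unitmx_perm. Qed.

Fact phi_mxK i : (phi_mx i *m phi_mx i = 1%:M)%R.
Proof.
rewrite mulmx_diag -diag_const_mx; congr diag_mx.
by apply/rowP=> j; rewrite !mxE; case: eqP; rewrite ?mulrNN mulr1.
Qed.

Fact phi_unit i : phi_mx i \in unitmx.
Proof. by case/mulmx1_unit: (phi_mxK i). Qed.

Definition sigmaGL : {'GL_d[F]} := FinRing.unit _ sigma_unit.
Definition phiGL i : {'GL_d[F]} := FinRing.unit _ (phi_unit i).

(* The affine group: 'rV[F]_d extended by GL acting by right multiplication,    *)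
(* so that sdpair1 _ v ^ sdpair2 _ x = sdpair1 _ (v *m x).                      *)
Definition AGL : finGroupType :=
  sdprod_groupType ('MR (GLrepr F r.-1))%gact.

Definition transl (v : 'rV[F]_d) : AGL := sdpair1 _ v.
Definition linear_part (x : {'GL_d[F]}) : AGL := sdpair2 _ x.

Definition sigma : AGL := linear_part sigmaGL.
Definition phi (i : 'I_d) : AGL := linear_part (phiGL i).

(* GgrpE below: Ggrp is the iterated semidirect product N ><| S ><| <[sigma]>.  *)
Definition Ngrp : {group AGL} := (sdpair1 _ @* [set: 'rV[F]_d])%G.
Definition Sgrp : {group AGL} := <<[set phi i | i : 'I_d]>>%G.
Definition Ggrp : {group AGL} := (Ngrp <*> Sgrp <*> <[sigma]>)%G.

Definition gelt : AGL := transl (delta_mx 0 ord_max)%R * sigma.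

Lemma transl_conj v x : transl v ^ linear_part x = transl (v *m x)%R.
Proof. by rewrite -sdpair_act ?inE //= mx_repr_actE ?inE. Qed.

Fact phi_sigma_mx i : (phi_mx i *m sigma_mx = sigma_mx *m phi_mx (ordS i))%R.
Proof.
rewrite mul_mx_diag mul_diag_mx; apply/matrixP=> a b; rewrite !mxE permE.
have [<-|_] := eqVneq (ordS a) b; last by rewrite !mulr0 ?mul0r.
by rewrite (inj_eq (@ordS_inj _)) mulr1 mul1r.
Qed.

Lemma phi_sigma i : phi i ^ sigma = phi (ordS i).
Proof.
rewrite /phi /sigma /linear_part -morphJ ?inE //; congr (sdpair2 _ _).
by rewrite conjgE; apply: (canLR (mulKg _)); apply: val_inj; apply: phi_sigma_mx.
Qed.

Let DG : {set {'GL_d[F]}} := [set u | is_diag_mx (val u)].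

Fact diagGL_group_set : group_set DG.
Proof.
apply/group_setP; split=> [|u v]; rewrite !inE.
  exact: scalar_mx_is_diag.
move=> /is_diag_mxP Du /is_diag_mxP Dv; apply/is_diag_mxP=> i j nij.
rewrite mxE big1 // => k _.
have [eik|nik] := eqVneq i k; last by rewrite Du ?mul0r.
by rewrite Dv ?mulr0 // -eik.
Qed.

Fact phi_sigma_TI : <<[set phiGL i | i : 'I_d]>> :&: <[sigmaGL]> = 1.
Proof.
have sD : <<[set phiGL i | i : 'I_d]>> \subset Group diagGL_group_set.
  rewrite gen_subG; apply/subsetP=> _ /imsetP[i _ ->].
  by rewrite inE; apply: diag_mx_is_diag.
apply/trivgP/subsetP=> u /setIP[/(subsetP sD)]; rewrite !inE => Du /cycleP[k eu].
pose s := perm (@ordS_inj d).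
have uE : val u = perm_mx (s ^+ k) :> 'M[F]_d.
  rewrite {}eu {Du}; elim: k => [|k IHk]; first by rewrite perm_mx1.
  by rewrite !expgSr perm_mxM -IHk.
suff s1 : s ^+ k = 1 by apply/eqP/val_inj; rewrite uE s1 perm_mx1.
apply/permP=> i; rewrite perm1; apply/eqP; apply: contraT => nsi.
have /is_diag_mxP/(_ i ((s ^+ k) i)) := Du.
rewrite uE !mxE eqxx eq_sym => /(_ nsi)/eqP.
by rewrite oner_eq0.
Qed.

Fact SgrpE : Sgrp = (linear_part @* <<[set phiGL i | i : 'I_d]>>)%G.
Proof.
apply: val_inj => /=; rewrite morphim_gen ?subsetT //; congr <<_>>.
by rewrite morphimEsub ?subsetT // -imset_comp.
Qed.

Lemma GgrpE : Ngrp ><| Sgrp ><| <[sigma]> = Ggrp.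
Proof.
have sSL : Sgrp \subset sdpair2 _ @* setT by rewrite SgrpE morphimS ?subsetT.
have sgL : <[sigma]> \subset sdpair2 _ @* setT by rewrite cycle_subG mem_morphim ?inE.
have nN := im_sdpair_norm ('MR (GLrepr F r.-1))%gact.
have NL1 := im_sdpair_TI ('MR (GLrepr F r.-1))%gact.
have nNS : Sgrp \subset 'N(Ngrp) := subset_trans sSL nN.
have nNg : <[sigma]> \subset 'N(Ngrp) := subset_trans sgL nN.
have nSg : <[sigma]> \subset 'N(Sgrp).
  apply: norms_gen; rewrite cycle_subG inE; apply/subsetP=> x.
  by case/imsetP=> _ /imsetP[i _ ->] ->; rewrite phi_sigma imset_f.
rewrite sdprodEY //; last by apply/trivgP; rewrite -NL1 setIS.
rewrite sdprodEY ?normsY //.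
have -> : (Ngrp <*> Sgrp) :&: <[sigma]> = Sgrp :&: <[sigma]>.
  apply/eqP; rewrite eqEsubset; apply/andP; split; last exact: setSI (joing_subr _ _).
  rewrite subsetI subsetIr andbT.
  apply: subset_trans (setIS _ sgL) _.
  by rewrite norm_joinEr // setIC -group_modr // setIC NL1 mul1g.
rewrite SgrpE /= /sigma /linear_part -morphim_cycle ?inE //.
by rewrite -injmI ?injm_sdpair2 ?subsetT // phi_sigma_TI morphim1.
Qed.

Lemma gelt_in : gelt \in Ggrp :\: Sgrp.
Proof.
have vN : transl (delta_mx 0 ord_max)%R \in Ngrp by rewrite mem_morphim ?inE.
apply/setDP; split.
  apply: groupM; last by apply: (subsetP (joing_subr _ _)); apply: cycle_id.
  by do 2!apply: (subsetP (joing_subl _ _)).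
apply/negP=> Sg.
have : transl (delta_mx 0 ord_max)%R \in sdpair2 ('MR (GLrepr F r.-1)) @* setT.
  rewrite -(groupMr _ (x := sigma)) ?mem_morphim ?inE //.
  by move: Sg; rewrite SgrpE; apply: subsetP; rewrite morphimS ?subsetT.
move=> vL; have := introT setIP (conj vN vL); rewrite im_sdpair_TI => /set1P.
rewrite -(morph1 (sdpair1_morphism ('MR (GLrepr F r.-1)))).
move/(injmP (injm_sdpair1 _)) => /(_ (in_setT _) (in_setT _)).
by move/rowP/(_ ord_max)/eqP; rewrite !mxE !eqxx oner_eq0.
Qed.

Definition Gamma : sgraph {set AGL} := coset_graph gelt_in.

End Construction.

(* Main.v *)
Require Import Defs.
From mathcomp Require Import all_boot all_order all_fingroup all_algebra.
From mathcomp Require Import all_solvable all_field all_character.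

(** The group G is an extension of its translation subgroup N by S ><| <[sigma]>,
    and everything follows from two facts about it.

    First, N is contained in every nontrivial normal subgroup of G
    ([Ngrp_minimum]). It is self-centralising, so a nontrivial normal subgroup
    meets it nontrivially, and it is irreducible under S and sigma: as p is odd,
    sign changes isolate a multiple of a basis vector in any nonzero vector, and
    sigma permutes the basis transitively ([Ngrp_sub_normalised]). In particular N
    is the unique minimal normal subgroup, and the core of S in G is trivial.

    Second, N S is normal in G and G / (N S) is cyclic of order r, generated by
    the image of g = n sigma. This map from G onto a cyclic group of order r
    colours the vertices of the coset graph so that each edge joins consecutive
    colours. As r > 2, no element of G can reverse an edge, and the out- and
    in-neighbours of a vertex are distinct. There are two of each, because the
    index of S :&: S :^ g in S is the number of S-conjugates of n, namely n and
    its inverse ([index_Sgrp_conj]); and the graph is connected because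
    n sigma and n^-1 sigma, both in S g S, generate n^2, then n and
    all of G together with S ([Sgrp_gelt_gen]).

    For the normal quotients, let M be a nontrivial normal subgroup. It contains
    N, so M S is normal, G / (M S) is cyclic and generated by the image of g, the
    M-orbits on vertices correspond to the cosets of M S, and the quotient graph
    is the Cayley graph of G / (M S) for that generator: a cycle, or K_1 or
    K_2 when the index is 1 or 2 ([coset_graph_quotient_cycle]). The kernel on
    the orbits is M S ([nq_ker_block]), so cyclic quotients are oriented. Two
    cyclic quotients, by M and M', are never independent: the intersection of
    M S and M' S contains N and is contained in M S, so it defines a
    cycle which is at least as long. These arguments only use the two facts and
    are made for coset graphs in general
    ([coset_graph_basic_oriented_cycle_type]). *)

Set Implicit Arguments.
Unset Strict Implicit.
Unset Printing Implicit Defensive.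

Import GroupScope GRing.Theory.

(** * Graph isomorphisms and cycles *)

Section GraphIsomorphisms.

Variables (T U : finType) (Gam : sgraph T) (Del : sgraph U).

(** Isomorphisms onto the standard graphs are easier to give as parametrisations
    of the vertices of Gam by those of Del; the witness required by [graph_iso]
    goes the other way and is only constrained on [vset Gam]. *)
Lemma graph_iso_param (u0 : U) (h : U -> T) :
    {in vset Del &, injective h} -> h @: vset Del = vset Gam ->
    {in vset Del &, forall u v, adj Gam (h u) (h v) = adj Del u v} ->
  graph_iso Gam Del.
Proof.
move=> injh im_h adj_h.
pose f x := odflt u0 [pick u in vset Del | h u == x].
have fK : {in vset Del, cancel h f}.
  move=> u Du; rewrite /f; case: pickP => [v /andP[Dv /eqP/injh->] // | /(_ u)].
  by rewrite Du eqxx.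
exists f; split; rewrite -?im_h.
- by move=> _ _ /imsetP[u Du ->] /imsetP[v Dv ->]; rewrite !fK // => ->.
- rewrite -imset_comp -[RHS]imset_id; apply: eq_in_imset => u Du /=.
  exact: fK.
- by move=> _ _ /imsetP[u Du ->] /imsetP[v Dv ->]; rewrite !fK // adj_h.
Qed.

Lemma graph_iso_eq_adj (Del' : sgraph U) :
  vset Del = vset Del' -> adj Del =2 adj Del' ->
  graph_iso Gam Del -> graph_iso Gam Del'.
Proof.
move=> eqV eqA [f [injf imf adjf]]; exists f.
by split; rewrite -?eqV // => x y Vx Vy; rewrite -eqA adjf.
Qed.

End GraphIsomorphisms.

(** The definition of [cycle_graph] makes sense for one and two vertices, where
    all pairs of distinct vertices are consecutive; so the three shapes of
    quotient allowed in a basic pair can all be treated as cycles. *)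
Lemma cycle_complete m : m <= 2 -> adj (cycle_graph m) =2 adj (complete_graph m).
Proof.
by case: m => [|[|[|//]]] _ [[|[|i]] lti] [[|[|j]] ltj].
Qed.

(** The neighbours of a vertex of a cycle are its successor and predecessor. *)
Lemma cycle_valency (T : finType) (Gam : sgraph T) x :
  is_cycle Gam -> x \in vset Gam -> #|[set y | adj Gam x y]| <= 2.
Proof.
case=> m _ [f [injf _ adjf]] Vx.
have sV : [set y | adj Gam x y] \subset vset Gam.
  by apply/subsetP=> y; rewrite inE adj_sym; apply: adj_vset.
rewrite -(card_in_imset (sub_in2 (subsetP sV) injf)).
apply: leq_trans (subset_leq_card _) (_ : #|[set ordS (f x); ord_pred (f x)]| <= 2).
  apply/subsetP=> _ /imsetP[y xy ->]; have Vy := subsetP sV y xy.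
  move: xy; rewrite !inE -adjf //= => /andP[_ /orP[/eqP->|/eqP->]].
    by rewrite eqxx.
  by rewrite ordSK eqxx orbT.
by rewrite cards2; case: (_ != _).
Qed.

(** The length is the number of vertices, so it can be read off from any
    isomorphism with some [cycle_graph m], even one with [m] at most 2. *)
Lemma is_cycle_card (T : finType) (Gam : sgraph T) m :
  graph_iso Gam (cycle_graph m) -> is_cycle Gam -> 2 < m.
Proof.
have cardV k : graph_iso Gam (cycle_graph k) -> #|vset Gam| = k.
  by case=> f [injf imf _]; rewrite -(card_in_imset injf) imf cardsT card_ord.
by move/cardV=> <- [k k_gt2 /cardV->].
Qed.

(** The trivial group must be ruled out separately when cyclic quotients are
    classified: its quotient is Gam again, with vertices turned into singletons. *)
Lemma is_cycle_quotient1 (aT : finGroupType) (T : finType)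
    (to : {action aT &-> T}) (Gam : sgraph T) :
  is_cycle (normal_quotient to Gam 1) -> is_cycle Gam.
Proof.
have orb1 x : orbit to 1 x = [set x] by apply/orbit1P; rewrite afix1 inE.
have defV : nq_vset to Gam 1 = set1 @: vset Gam by apply: eq_imset => x.
case=> m m_gt2 [f [injf imf adjf]]; exists m => //; exists (f \o set1).
split=> [x y Vx Vy | | x y Vx Vy].
- by move/injf/set1_inj; apply; rewrite /= defV imset_f.
- by rewrite imset_comp -defV.
rewrite -[LHS]/(adj (cycle_graph m) (f [set x]) (f [set y])) adjf /= ?defV ?imset_f //=.
rewrite /nq_adj defV !imset_f //=; apply/andP/idP=> [[_] | xy].
  by case/exists_inP=> _ /set1P-> /exists_inP[_ /set1P->].
split; first by apply: contraTneq xy => /set1_inj->; rewrite adj_irr.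
by apply/exists_inP; exists x; rewrite ?set11 //; apply/exists_inP; exists y; rewrite ?set11.
Qed.

(** * Coset graphs *)

Section CosetGraphs.

Variables (gT : finGroupType) (G S : {group gT}) (g : gT).
Hypotheses (gGS : g \in G :\: S) (sSG : S \subset G).
Local Notation Gam := (coset_graph gGS).

Let Gg : g \in G. Proof. by case/setDP: gGS. Qed.

(** The double coset of g is stable under multiplication by S on either side, so
    adjacency can be tested on any representatives of the two cosets. *)
Lemma coset_graph_adjE x y : x \in G -> y \in G ->
  adj Gam (S :* x) (S :* y)
    = (x * y^-1 \in S :* g * S) || (y * x^-1 \in S :* g * S).
Proof.
move=> Gx Gy /=.
have inv a b a' b' : S :* a = S :* a' -> S :* b = S :* b' ->
  a * b^-1 \in S :* g * S -> a' * b'^-1 \in S :* g * S.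
- move=> ea eb ab.
  have /rcosetP[s Ss ->] : a' \in S :* a by rewrite ea rcoset_refl.
  have /rcosetP[t St ->] : b' \in S :* b by rewrite eb rcoset_refl.
  case/mulsgP: ab => _ v /rcosetP[u Su ->] Sv eab.
  rewrite invMg mulgA -(mulgA s) {}eab !mulgA -mulgA.
  by rewrite mem_mulg ?groupM ?groupV // mem_rcoset mulgK groupM.
apply/idP/idP=> [|H].
  case/exists_inP=> x' Gx' /exists_inP[y' Gy' /and3P[/eqP ex /eqP ey]].
  by case/orP=> H; apply/orP; [left | right]; apply: inv H.
apply/exists_inP; exists x => //; apply/exists_inP; exists y => //.
by rewrite !eqxx.
Qed.

Lemma coset_graph_actE a X Y :
  a \in G -> adj Gam (('Rs)%act X a) (('Rs)%act Y a) = adj Gam X Y.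
Proof.
have imp b Z W : b \in G -> adj Gam Z W -> adj Gam (('Rs)%act Z b) (('Rs)%act W b).
  move=> Gb /= /exists_inP[x Gx /exists_inP[y Gy /and3P[/eqP-> /eqP-> e]]].
  apply/exists_inP; exists (x * b); rewrite ?groupM //.
  apply/exists_inP; exists (y * b); rewrite ?groupM //.
  by rewrite !rcosetE -!rcosetM !eqxx !invMg !mulgA !mulgK.
move=> Ga; apply/idP/idP; last exact: imp.
by move/(imp a^-1); rewrite groupV !actK; apply.
Qed.

(** Each edge, directed along g, is a translate of the base edge from S g to S:
    if x = s g t y with s, t in S, translate by t y. *)
Lemma coset_graph_edge x y : x \in G -> y \in G -> x * y^-1 \in S :* g * S ->
  exists2 a, a \in G &
    S :* x = ('Rs)%act (S :* g) a /\ S :* y = ('Rs)%act (S : {set gT}) a.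
Proof.
move=> Gx Gy /mulsgP[_ t /rcosetP[s Ss ->] St e].
have Gt := subsetP sSG t St.
exists (t * y); rewrite ?groupM //= !rcosetE -rcosetM; split.
  have -> : x = s * (g * (t * y)) by rewrite !mulgA -e mulgKV.
  by rewrite (rcosetM _ s) (rcoset_id Ss).
by rewrite (rcosetM _ t) (rcoset_id St).
Qed.

Lemma mem_dcoset_refl : g \in S :* g * S.
Proof. by rewrite -[X in X \in _]mulg1 mem_mulg ?rcoset_refl. Qed.

Lemma coset_graph_adj1E y : y \in G ->
  adj Gam S (S :* y) = (y^-1 \in S :* g * S) || (y \in S :* g * S).
Proof.
move=> Gy; have := coset_graph_adjE (group1 G) Gy.
by rewrite rcoset1 mul1g invg1 mulg1.
Qed.

Lemma coset_graph_adj1 : adj Gam (S :* g) S.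
Proof. by rewrite adj_sym coset_graph_adj1E // mem_dcoset_refl orbT. Qed.

Lemma coset_graph_edge_transitive : [transitive G, on edges Gam | ('Rs)^*].
Proof.
have adj1 := coset_graph_adj1.
apply/imsetP; exists [set S :* g; S : {set _}].
  by apply/imsetP; exists (S :* g, S : {set _}); rewrite // inE.
have sub x y : x \in G -> y \in G -> x * y^-1 \in S :* g * S ->
    [set S :* x; S :* y] \in orbit (('Rs)^*)%act G [set S :* g; S : {set _}].
  move=> Gx Gy /(coset_graph_edge Gx Gy)[a Ga [-> ->]].
  by apply/imsetP; exists a; rewrite //= setactE imsetU1 imset_set1.
apply/setP=> E; apply/imsetP/idP=> [[[X Y]] | /imsetP[a Ga ->]].
  rewrite inE => /exists_inP[x Gx /exists_inP[y Gy /and3P[/eqP eX /eqP eY]]] /=.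
  rewrite /= in eX eY; rewrite {}eX {}eY => /orP[] e ->; first exact: sub.
  by rewrite setUC sub.
exists (('Rs)%act (S :* g) a, ('Rs)%act (S : {set _}) a).
  by rewrite inE coset_graph_actE.
by rewrite /= setactE imsetU1 imset_set1.
Qed.

(** The elements h such that S x and S (h x) are in the same component for every x
    form a subgroup containing S (no move at all) and g (a single edge). *)
Lemma coset_graph_connected : <<S :|: [set g]>> = G -> connected Gam.
Proof.
move=> genG.
pose e := connect (adj Gam).
have esym : symmetric e by apply: sym_connect_sym => X Y; apply: adj_sym.
pose A := [set h in G | [forall x in G, e (S :* x) (S :* (h * x))]].
have gA : group_set A.
  apply/group_setP; split=> [|h k].
    rewrite inE group1; apply/forall_inP=> x _; rewrite mul1g; exact: connect0.
  rewrite !inE => /andP[Gh /forall_inP eh] /andP[Gk /forall_inP ek].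
  rewrite groupM //; apply/forall_inP=> x Gx; apply: connect_trans (ek x Gx) _.
  by have := eh _ (groupM Gk Gx); rewrite mulgA.
have sGA : G \subset Group gA.
  rewrite -genG gen_subG subUset sub1set; apply/andP; split.
    apply/subsetP=> s Ss; rewrite inE (subsetP sSG) //; apply/forall_inP=> x _.
    by rewrite (rcosetM _ s) (rcoset_id Ss); exact: connect0.
  rewrite inE Gg; apply/forall_inP=> x Gx; apply: connect1.
  by rewrite adj_sym coset_graph_adjE ?groupM // mulgK mem_dcoset_refl.
move=> _ _ /rcosetsP[x Gx ->] /rcosetsP[y Gy ->].
have : y * x^-1 \in A by rewrite (subsetP sGA) // groupM ?groupV.
by rewrite inE => /andP[_ /forall_inP/(_ x Gx)]; rewrite mulgKV.
Qed.

(** An element a reversing the base edge would have both a and g a in the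
    cosets S g and S, whence g^2 in any overgroup L of S normalised by g. *)
Lemma coset_graph_not_arc_transitive (L : {group gT}) :
  S \subset L -> g \in 'N(L) -> g ^+ 2 \notin L -> ~ arc_transitive G 'Rs Gam.
Proof.
move=> sSL nLg nLg2 arcT.
have adj1 := coset_graph_adj1.
have adj2 := adj1; rewrite adj_sym in adj2.
have [a _ [/= e1 e2]] := arcT _ _ _ _ adj1 adj2.
case/negP: nLg2.
have /rcosetP[s Ss ea] : a \in S :* g by rewrite -e2 rcosetE rcoset_refl.
have : g * a \in S by rewrite -e1 rcosetE -rcosetM rcoset_refl.
move/(subsetP sSL); rewrite ea expgS expg1 mulgA.
have -> : g * s * g = (s ^ g^-1) * (g * g) by rewrite conjgE invgK !mulgA mulgKV.
by rewrite groupMl // memJ_norm ?groupV ?(subsetP sSL).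
Qed.

Lemma coset_graph_faithful : gcore S G = 1 -> [faithful G, on vset Gam | 'Rs].
Proof. by move=> coreS; rewrite /faithful astabRs_rcosets coreS subsetIr. Qed.

Lemma orbit_rcoset_index (x : gT) : #|orbit 'Rs S (S :* x)| = #|S : S :&: S :^ x|.
Proof.
rewrite card_orbit; congr #|_ : _ :&: _|.
by rewrite -rcosetE astab1_act astab1Rs.
Qed.

(** The out- and in-neighbours of the vertex S are the S-orbits of S g and of
    S g^-1. They have the same size, the stabilisers S :&: S :^ g and
    S :&: S :^ g^-1 being conjugate by g, and they are disjoint unless
    g^-1 is in S g S. *)
Lemma coset_graph_valent :
  g^-1 \notin S :* g * S -> valent (#|S : S :&: S :^ g| * 2) Gam.
Proof.
move=> nSgS.
have eqI : #|S : S :&: S :^ g^-1| = #|S : S :&: S :^ g|.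
  rewrite -!divgS ?subsetIl //; congr (_ %/ _)%N.
  by rewrite -[LHS](cardJg _ g) conjIg -conjsgM mulVg conjsg1 setIC.
suff nb1 : [set Y | adj Gam S Y] = orbit 'Rs S (S :* g) :|: orbit 'Rs S (S :* g^-1).
  move=> _ /rcosetsP[x Gx ->].
  have -> : [set Y | adj Gam (S :* x) Y] = ('Rs)%act^~ x @: [set Y | adj Gam S Y].
    apply/setP=> Y; apply/idP/imsetP=> [|[Z]]; rewrite !inE => SY.
      exists (('Rs)%act Y x^-1); last by rewrite actKV.
      by rewrite inE -(coset_graph_actE _ _ Gx) actKV /= rcosetE.
    by move->; rewrite -rcosetE coset_graph_actE.
  rewrite (card_imset _ (act_inj _ x)) nb1 cardsU !orbit_rcoset_index eqI.
  rewrite muln2 -addnn [X in _ - X]eq_card0 ?subn0 // => Z.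
  apply/negP=> /setIP[/imsetP[s Ss ->]] /imsetP[t St] /=.
  rewrite !rcosetE -!rcosetM => e; case/negP: nSgS.
  have /rcosetP[u Su e'] : g^-1 * t \in S :* (g * s) by rewrite e rcoset_refl.
  have -> : g^-1 = u * g * (s * t^-1) by rewrite -(mulgK t g^-1) e' !mulgA.
  by rewrite mem_mulg ?groupMl ?groupV // mem_rcoset mulgK.
have Gs s : s \in S -> s \in G by apply: subsetP.
apply/setP=> Y; rewrite inE in_setU; apply/idP/orP=> [SY|].
  have /rcosetsP[y Gy eY] : Y \in rcosets S G by rewrite adj_sym in SY; exact: adj_vset SY.
  move: SY; rewrite eY coset_graph_adj1E //.
  case/orP=> /mulsgP[_ t /rcosetP[s Ss ->] St e]; [right | left]; apply/imsetP.
    exists s^-1; rewrite ?groupV //= rcosetE -rcosetM -[y]invgK e !invMg (rcosetM _ t^-1).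
    by rewrite (rcoset_id (_ : t^-1 \in S)) ?groupV.
  by exists t; rewrite //= rcosetE -rcosetM e -mulgA (rcosetM _ s) (rcoset_id Ss).
case=> /imsetP[s Ss ->]; rewrite [('Rs)%act _ s]/= rcosetE -rcosetM.
  have Ggs : g * s \in G by rewrite groupM // Gs.
  by rewrite coset_graph_adj1E // mem_mulg ?rcoset_refl ?orbT.
have Ggs : g^-1 * s \in G by rewrite groupM ?groupV // Gs.
rewrite coset_graph_adj1E // invMg invgK -[s^-1 * g]mulg1.
by rewrite mem_mulg // mem_rcoset mulgK groupV.
Qed.
End CosetGraphs.

(** * Normal quotients of coset graphs *)

(** In this section L = M S is normal in G, with G / L generated by the image of
    g. The M-orbits on vertices are then the blocks of right cosets of S
    contained in a given coset of L, and every edge joins the block of L x to that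
    of L g x or of L g^-1 x; so the quotient is the Cayley graph of the cyclic
    group G / L with respect to the image of g. *)
Section CosetGraphQuotients.

Variables (gT : finGroupType) (G S : {group gT}) (g : gT).
Hypotheses (gGS : g \in G :\: S) (sSG : S \subset G).
Local Notation Gam := (coset_graph gGS).

Variables L M : {group gT}.
Hypotheses (nsLG : L <| G) (nsMG : M <| G) (defL : M * S = L).
Hypothesis GLg : G / L = <[coset L g]>.

Let Gg : g \in G. Proof. by case/setDP: gGS. Qed.
Let nLG x : x \in G -> x \in 'N(L). Proof. exact: subsetP (normal_norm nsLG) x. Qed.
Let sSL : S \subset L. Proof. by rewrite -defL mulG_subr. Qed.

(** [rcosets S (L :* x)] is the block of vertices lying in the coset L x; thanks
    to S \subset L, the block determines the coset of L. *)
Lemma mem_rcosets_block x y : (S :* y \in rcosets S (L :* x)) = (y \in L :* x).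
Proof. by rewrite mem_rcosets mulgA mulSGid. Qed.

Lemma orbit_block x : x \in G -> orbit 'Rs M (S :* x) = rcosets S (L :* x).
Proof.
move=> Gx; have nMx : x \in 'N(M) := subsetP (normal_norm nsMG) x Gx.
apply/setP=> Y; apply/imsetP/rcosetsP=> [[m Mm ->] | [y]].
  exists (x * m); last by rewrite /= rcosetE rcosetM.
  rewrite conjgCV mem_rcoset mulgK (subsetP _ _ (_ : _ \in M)) //.
    by rewrite -defL mulG_subl.
  by rewrite memJ_norm ?groupV.
case/rcosetP=> l Ll -> ->; move: Ll; rewrite -defL => /mulsgP[m s Mm Ss ->].
have nMs : s \in 'N(M) by rewrite (subsetP (normal_norm nsMG)) ?(subsetP sSG).
exists (m ^ (s * x)); first by rewrite memJ_norm ?groupM.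
rewrite /= rcosetE -rcosetM.
have -> : m * s * x = s * (x * m ^ (s * x)) by rewrite conjgE invMg !mulgA mulgK !mulgV mul1g.
by rewrite (rcosetM _ s) (rcoset_id Ss).
Qed.

Lemma nq_vset_blocks : nq_vset 'Rs Gam M = [set rcosets S (L :* x) | x in G].
Proof.
apply/setP=> A; apply/imsetP/imsetP=> [[_ /rcosetsP[x Gx ->] ->] | [x Gx ->]].
  by exists x; rewrite ?orbit_block.
by exists (S :* x); rewrite ?orbit_block //; apply/rcosetsP; exists x.
Qed.

Lemma block_nq_vset x : x \in G -> rcosets S (L :* x) \in nq_vset 'Rs Gam M.
Proof. by move=> Gx; rewrite nq_vset_blocks; apply/imsetP; exists x. Qed.

Lemma eq_blocks x y : x \in G -> y \in G ->
  (rcosets S (L :* x) == rcosets S (L :* y)) = (coset L x == coset L y).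
Proof.
move=> Gx Gy; apply/eqP/eqP=> [exy | /(rcoset_kercosetP (nLG Gx) (nLG Gy))/rcoset_eqP-> //].
apply/(rcoset_kercosetP (nLG Gx) (nLG Gy)).
by rewrite -mem_rcosets_block -exy mem_rcosets_block rcoset_refl.
Qed.

Lemma nq_adj_blocks x y : x \in G -> y \in G ->
  nq_adj 'Rs Gam M (rcosets S (L :* x)) (rcosets S (L :* y))
    = (coset L x != coset L y)
      && ((coset L x == coset L g * coset L y) || (coset L y == coset L g * coset L x)).
Proof.
move=> Gx Gy; rewrite /nq_adj !block_nq_vset // eq_blocks // !andTb.
congr (_ && _).
have cosS s : s \in S -> coset L s = 1 by move=> Ss; rewrite coset_id ?(subsetP sSL).
have cosL u v : u \in G -> v \in L :* u -> v \in G /\ coset L v = coset L u.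
  move=> Gu Luv.
  have Gv : v \in G by case/rcosetP: Luv => l Ll ->; rewrite groupM // (subsetP (normal_sub nsLG)).
  by split=> //; apply/(rcoset_kercosetP (nLG Gv) (nLG Gu)).
have step u v : u \in G -> v \in G -> u * v^-1 \in S :* g * S -> coset L u = coset L g * coset L v.
  move=> Gu Gv /mulsgP[_ t /rcosetP[s Ss ->] St e].
  have Gs := subsetP sSG s Ss; have Gt := subsetP sSG t St.
  rewrite -(mulgKV v u) e !morphM ?nLG ?groupM //=.
  by rewrite (cosS s Ss) (cosS t St) mul1g mulg1.
have step' u v : u \in G -> v \in G -> coset L u = coset L g * coset L v -> (g * v \in L :* u).
  move=> Gu Gv e; apply/(rcoset_kercosetP (nLG (groupM Gg Gv)) (nLG Gu)).
  by rewrite e morphM ?nLG.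
apply/exists_inP/orP=> [[_ /rcosetsP[u Lxu ->]] | [] /eqP e].
- case/exists_inP=> _ /rcosetsP[v Lyv ->].
  have [Gu <-] := cosL _ _ Gx Lxu; have [Gv <-] := cosL _ _ Gy Lyv.
  rewrite coset_graph_adjE // => /orP[] /step e; [left | right]; exact/eqP/e.
- exists (S :* (g * y)); first by rewrite mem_rcosets_block step'.
  apply/exists_inP; exists (S :* y); first by rewrite mem_rcosets_block rcoset_refl.
  by rewrite coset_graph_adjE ?groupM // mulgK mem_dcoset_refl.
exists (S :* x); first by rewrite mem_rcosets_block rcoset_refl.
apply/exists_inP; exists (S :* (g * x)); first by rewrite mem_rcosets_block step'.
by rewrite coset_graph_adjE ?groupM // mulgK mem_dcoset_refl orbT.
Qed.

(** The vertex i of the cycle is the block of L g^i; the order of g modulo L is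
    the index of L, so each block occurs exactly once. *)
Theorem coset_graph_quotient_cycle :
  graph_iso (normal_quotient 'Rs Gam M) (cycle_graph #|G : L|).
Proof.
have eqm : #|G : L| = #[coset L g] by rewrite -card_quotient ?normal_norm // GLg.
have m_gt0 : 0 < #|G : L| by rewrite indexg_gt0.
have Gg_ n : g ^+ n \in G by rewrite groupX.
pose h (i : 'I_#|G : L|) := rcosets S (L :* g ^+ i).
have eq_h (a b : nat) : (coset L (g ^+ a) == coset L (g ^+ b)) = (a == b %[mod #|G : L|]).
  by rewrite !morphX ?nLG // eqm; apply: eq_expg_mod_order.
apply: (graph_iso_param (Ordinal m_gt0) (h := h)) => [i j _ _ | | i j _ _] /=.
- by move/eqP; rewrite eq_blocks // eq_h !modn_small // => /eqP/val_inj.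
- rewrite nq_vset_blocks; apply/setP=> A; apply/imsetP/imsetP=> [[i _ ->] | [x Gx ->]].
    by exists (g ^+ i).
  have : coset L x \in <[coset L g]> by rewrite -GLg mem_quotient.
  case/cyclePmin=> k; rewrite -eqm => ltkm ex; exists (Ordinal ltkm) => //.
  by apply/eqP; rewrite eq_blocks // ex morphX ?nLG.
rewrite nq_adj_blocks // /cycle_adj eq_h !modn_small // orbC.
rewrite -!morphM ?nLG // -!expgS !eq_h.
by rewrite !(modn_small (ltn_ord _)).
Qed.

(** Right translation by a moves the block of L x to that of L x a, which is the
    same block for one x, hence for all, exactly when a is in L. *)
Lemma nq_ker_block : nq_ker G 'Rs Gam M = L.
Proof.
have act_block x a : x \in G -> a \in G ->
    (('Rs)^*)%act (rcosets S (L :* x)) a = rcosets S (L :* (x * a)).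
  move=> Gx Ga; rewrite -!orbit_block ?groupM //.
  apply: etrans (setact_orbit _ _ _ _) _; rewrite /= rcosetE -rcosetM.
  by rewrite (normsP (normal_norm nsMG)).
apply: val_inj => /=; apply/setP=> a; apply/setIP/idP=> [[Ga] | La].
  move/astabP/(_ _ (block_nq_vset (group1 G))); rewrite act_block // mul1g.
  move/eqP; rewrite eq_blocks // morph1 => /eqP/coset_idr; apply; exact: nLG.
have Ga := subsetP (normal_sub nsLG) a La.
split=> //; apply/astabP=> A; rewrite nq_vset_blocks => /imsetP[x Gx ->].
by apply/eqP; rewrite act_block // eq_blocks ?groupM // morphM ?nLG //= (coset_id La) mulg1.
Qed.

Lemma coset_graph_quotient_basic :
  [\/ graph_iso (normal_quotient 'Rs Gam M) (complete_graph 1),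
      graph_iso (normal_quotient 'Rs Gam M) (complete_graph 2)
    | is_cycle (normal_quotient 'Rs Gam M)].
Proof.
have iso := coset_graph_quotient_cycle; have := indexg_gt0 G L.
case: {2}#|G : L| (erefl #|G : L|) => [|[|[|m]]] eqm; rewrite ?eqm // => _.
- apply: Or31; rewrite eqm in iso; apply: graph_iso_eq_adj iso => //; exact: cycle_complete.
- apply: Or32; rewrite eqm in iso; apply: graph_iso_eq_adj iso => //; exact: cycle_complete.
by apply: Or33; exists #|G : L|; rewrite ?eqm // -eqm.
Qed.

End CosetGraphQuotients.

(** * Coset graphs of groups with a smallest normal subgroup *)

(** Here N is the minimum of the nontrivial normal subgroups of G, it meets S
    trivially, and N S is normal with G / (N S) cyclic of order at least 3,
    generated by the image of g. The trivial subgroup being excluded by the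
    valency, all the cyclic quotients come from normal subgroups above N, and the
    previous section applies to each of them. *)
Section BasicCosetGraphs.

Variables (gT : finGroupType) (G S N : {group gT}) (g : gT).
Hypotheses (gGS : g \in G :\: S) (sSG : S \subset G).
Local Notation Gam := (coset_graph gGS).

Hypotheses (nsNG : N <| G) (ntN : N :!=: 1) (tiNS : N :&: S = 1).
Hypothesis minN : forall M : {group gT}, M <| G -> M :!=: 1 -> N \subset M.
Hypotheses (nsNSG : N <*> S <| G) (defG : N <*> S * <[g]> = G).
Hypothesis index_gt2 : 2 < #|G : N <*> S|.

Let Gg : g \in G. Proof. by case/setDP: gGS. Qed.

(** As G / (N S) is cyclic, N S contains the derived subgroup of G; every
    subgroup above N S is therefore normal with a cyclic quotient. *)
Lemma join_overgroup (M : {group gT}) : M <| G -> N \subset M ->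
  [/\ M <*> S <| G, M * S = M <*> S & G / (M <*> S) = <[coset (M <*> S) g]>].
Proof.
move=> nsMG sNM; have [sMG nMG] := andP nsMG.
have sKL : N <*> S \subset M <*> S by apply: genS (setSU _ sNM).
have cycGK : G / (N <*> S) = <[coset (N <*> S) g]>.
  rewrite -[in LHS]defG quotientMl ?normG // trivg_quotient mul1g.
  by rewrite quotient_cycle // (subsetP (normal_norm nsNSG)).
have nsLG : M <*> S <| G.
  apply: sub_der1_normal; last by rewrite join_subG sMG.
  apply: subset_trans sKL; apply: der1_min; first exact: normal_norm.
  by rewrite cycGK cycle_abelian.
split=> //; first by rewrite norm_joinEr ?(subset_trans sSG).
have -> : G :=: M <*> S * <[g]>.
  apply/eqP; rewrite eqEsubset; apply/andP; split; first by rewrite -{1}defG mulSg.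
  by rewrite mul_subG ?cycle_subG // normal_sub.
rewrite quotientMl ?normG // trivg_quotient mul1g.
by rewrite quotient_cycle // (subsetP (normal_norm nsLG)).
Qed.

(** Otherwise the cyclic group G / (N S), generated by the image of g, would
    have order at most 2. *)
Lemma square_notin : g ^+ 2 \notin N <*> S.
Proof.
have [nsKG _ cycGK] := join_overgroup nsNG (subxx N).
have nKg : g \in 'N(N <*> S) := subsetP (normal_norm nsKG) g Gg.
apply: contraL index_gt2 => Kg2; rewrite -leqNgt -card_quotient ?normal_norm //=.
rewrite cycGK dvdn_leq // order_dvdn -morphX //=.
by apply/eqP; apply: coset_id.
Qed.

(** Modulo N S, all the elements of S g S are congruent to g. *)
Lemma inverse_notin_dcoset : g^-1 \notin S :* g * S.
Proof.
have nKg : g \in 'N(N <*> S) := subsetP (normal_norm nsNSG) g Gg.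
apply: contra square_notin => /mulsgP[_ t /rcosetP[s Ss ->] St e].
have sSK : S \subset N <*> S := joing_subr N S.
have Ks := subsetP sSK s Ss; have Kt := subsetP sSK t St.
have e1 : (s * g * t) * g = 1 by rewrite -e mulVg.
have : (s * g * t) * g \in N <*> S by rewrite e1 group1.
have -> : s * g * t * g = s * g ^+ 2 * t ^ g by rewrite conjgE expgS expg1 !mulgA mulgK.
by rewrite groupMr ?memJ_norm // groupMl.
Qed.

(** Faithfulness holds because the core of S in G, being normal and disjoint from
    N, cannot contain N. *)
Theorem coset_graph_OG4 :
  <<S :|: [set g]>> = G -> #|S : S :&: S :^ g| = 2 -> OG4 G 'Rs Gam.
Proof.
move=> genG idx2; split; first exact: coset_graph_connected.
- by have := coset_graph_valent (gGS := gGS) sSG inverse_notin_dcoset; rewrite idx2.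
- split; first exact: actsRs_rcosets.
    apply: coset_graph_faithful; apply/eqP; apply: contraT => nt.
    have nsC : gcore S G <| G by rewrite gcore_normal.
    have := minN nsC nt; move/subset_trans/(_ (gcore_sub S G))/setIidPl.
    by rewrite tiNS => eN; case/eqP: ntN.
  by move=> a Ga X Y; apply: coset_graph_actE.
split; first exact: transRs_rcosets.
  exact: coset_graph_edge_transitive.
apply: (@coset_graph_not_arc_transitive _ _ _ _ _ (N <*> S)%G) => /=.
- exact: joing_subr.
- exact: subsetP (normal_norm nsNSG) g Gg.
exact: square_notin.
Qed.

(** A cyclic quotient by M has M nontrivial, since the trivial group gives back a
    graph of valency 4; so N \subset M, the kernel is M S, and the group induced
    is the cyclic group G / (M S), acting as rotations: the quotient is oriented.
    For two such subgroups M and M', the intersection K of the kernels M S and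
    M' S contains N S, and its index is at least that of M S: the quotient by K
    is again a cycle. *)
Theorem coset_graph_basic_oriented_cycle_type :
  OG4 G 'Rs Gam -> basic_oriented_cycle_type G 'Rs Gam.
Proof.
move=> og4; have [_ val4 _ _] := og4.
have cycN M : cyclic_quotient G 'Rs Gam M -> N \subset M.
  case=> nsM cycM; apply: minN => //; apply: contraPneq cycM => -> /is_cycle_quotient1 cyc1.
  have V1 : (S : {set gT}) \in vset Gam by apply/rcosetsP; exists 1; rewrite ?rcoset1.
  by have := cycle_valency cyc1 V1; rewrite val4.
have idxM (M : {group gT}) : cyclic_quotient G 'Rs Gam M -> 2 < #|G : M <*> S|.
  move=> cM; have [nsM cycM] := cM; have [nsL defL GL] := join_overgroup nsM (cycN M cM).
  exact: is_cycle_card (coset_graph_quotient_cycle (L := (M <*> S)%G) gGS sSG nsL nsM defL GL) cycM.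
have kerM (M : {group gT}) : cyclic_quotient G 'Rs Gam M ->
    nq_ker G 'Rs Gam M = (M <*> S)%G.
  move=> cM; have [nsM _] := cM; have [nsL defL GL] := join_overgroup nsM (cycN M cM).
  exact: (nq_ker_block (L := (M <*> S)%G) gGS sSG nsL nsM defL).
split.
- split=> // M nsM ntM; have [nsL defL GL] := join_overgroup nsM (minN nsM ntM).
  exact: (coset_graph_quotient_basic (L := (M <*> S)%G) gGS sSG nsL nsM defL GL).
- exists N; split=> //; have [nsL defL GL] := join_overgroup nsNG (subxx N).
  exists #|G : N <*> S| => //.
  exact: (coset_graph_quotient_cycle (L := (N <*> S)%G) gGS sSG nsL nsNG defL GL).
- move=> M M' cM cM'; apply; rewrite (kerM M) // (kerM M') //.
  have [nsL _ _] := join_overgroup cM.1 (cycN M cM).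
  have [nsL' _ _] := join_overgroup cM'.1 (cycN M' cM').
  set K := ((M <*> S) :&: (M' <*> S))%G.
  have nsK : K <| G by rewrite /normal subIset ?(normal_sub nsL) // normsI ?normal_norm.
  have sNK : N \subset K.
    by rewrite subsetI !(subset_trans _ (joing_subl _ _)) ?cycN.
  have sSK : S \subset K by rewrite subsetI !joing_subr.
  have eK : (K <*> S)%G = K by apply: val_inj; apply/joing_idPl.
  have [nsKS defKS GKS] := join_overgroup nsK sNK.
  exists #|G : K <*> S|; last first.
    exact: (coset_graph_quotient_cycle (L := (K <*> S)%G) gGS sSG nsKS nsK defKS GKS).
  rewrite -[K <*> S]/(gval (K <*> S)%G) eK; apply: leq_trans (idxM M cM) _.
  by rewrite dvdn_leq ?indexg_gt0 // indexgS ?subsetIl.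
move=> M cM; have [nsM _] := cM; have [nsL defL GL] := join_overgroup nsM (cycN M cM).
exists #|G : M <*> S|; rewrite (kerM M cM); split; first exact: idxM.
- exact: (coset_graph_quotient_cycle (L := (M <*> S)%G) gGS sSG nsL nsM defL GL).
- by rewrite /= GL cycle_cyclic.
by rewrite card_quotient ?normal_norm.
Qed.

End BasicCosetGraphs.

(** * The affine group *)

Section AffineGroup.

Variables r p : nat.
Local Notation d := r.-1.+1.
Local Notation V := 'rV['F_p]_d.
Local Notation N := (Ngrp r p).
Local Notation S := (Sgrp r p).
Local Notation G := (Ggrp r p).
Local Notation e := (@delta_mx 'F_p 1 d 0%R).

Lemma translD (u v : V) : transl (u + v)%R = transl u * transl v.
Proof. by rewrite /transl -morphM ?inE. Qed.

Lemma transl0 : transl (0 : V)%R = 1.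
Proof. exact: (morph1 (sdpair1_morphism ('MR (GLrepr 'F_p r.-1)))). Qed.

Lemma translN (v : V) : transl (- v)%R = (transl v)^-1.
Proof. by apply/eqP; rewrite eq_sym eq_invg_mul -translD subrr transl0. Qed.

Lemma translMn (v : V) k : transl (v *+ k)%R = transl v ^+ k.
Proof. by elim: k => [|k IHk]; rewrite ?transl0 // mulrS expgS translD IHk. Qed.

Lemma transl_inj : injective (@transl r p).
Proof. by move=> u v; apply: (injmP (injm_sdpair1 _)); rewrite inE. Qed.

Lemma NgrpP x : reflect (exists v : V, x = transl v) (x \in N).
Proof.
apply: (iffP morphimP) => [[v _ _ ->] | [v ->]]; first by exists v.
by exists v; rewrite ?inE.
Qed.

(** A linear map acts faithfully by conjugation on the translations, and the basis
    vectors suffice to detect this. *)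
Lemma linear_part_fix_basis (u : AGL r p) :
    u \in sdpair2 ('MR (GLrepr 'F_p r.-1))%gact @* setT ->
  (forall i, transl (e i) ^ u = transl (e i)) -> u = 1.
Proof.
case/morphimP=> x _ _ -> fix_e; have -> : x = 1; last exact: morph1.
apply/val_inj/row_matrixP => i.
have := fix_e i; rewrite (transl_conj (e i) x) => /transl_inj ex.
by rewrite !rowE ex -rowE row1.
Qed.

Lemma Ngrp_selfcent : 'C(N) \subset N.
Proof.
apply/subsetP=> u; rewrite (sdpairE u) => cu.
set x := u.1 in cu *; set w := u.2 in cu *.
have cNN : transl w \in 'C(N).
  apply/centP=> _ /NgrpP[v ->]; red; by rewrite -!translD addrC.
have cx : sdpair2 ('MR (GLrepr 'F_p r.-1))%gact x \in 'C(N).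
  by rewrite -(groupMr _ cNN).
rewrite (linear_part_fix_basis (u := sdpair2 _ x)).
- by rewrite mul1g; apply/NgrpP; exists w.
- by rewrite mem_morphim ?inE.
move=> i; have Ne : transl (e i) \in N by apply/NgrpP; exists (e i).
by rewrite conjgE -(centP cx _ Ne) mulKg.
Qed.

Lemma delta_sigma i : transl (e i) ^ sigma r p = transl (e (ordS i)).
Proof.
rewrite transl_conj /= -rowE; congr transl; apply/rowP=> j.
by rewrite !mxE permE eq_sym.
Qed.

Lemma mul_phi_mx (v : V) i j : ((v *m phi_mx p i) 0 j = if j == i then - v 0 j else v 0 j)%R.
Proof. by rewrite mul_mx_diag !mxE; case: eqP; rewrite ?mulrN mulr1. Qed.

Lemma delta_phi i j : transl (e i) ^ phi p j = if i == j then (transl (e i))^-1 else transl (e i).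
Proof.
rewrite transl_conj /=; case: (eqVneq i j) => [<- | nij].
  rewrite -translN; congr transl; apply/rowP=> k.
  by rewrite mul_phi_mx !mxE; case: (k == i); rewrite ?oppr0.
congr transl; apply/rowP=> k; rewrite mul_phi_mx !mxE.
by case: (eqVneq k j) => // ->; rewrite eq_sym (negPf nij) oppr0.
Qed.

Lemma val_iter_ordS m (i : 'I_m) k : val (iter k (@ordS m) i) = (i + k) %% m.
Proof.
elim: k => [|k IHk]; first by rewrite addn0 modn_small.
by rewrite iterS /= IHk addnS -addn1 modnDml addn1.
Qed.

Lemma delta_sigmaX i k :
  transl (e i) ^ (sigma r p ^+ k) = transl (e (iter k (@ordS d) i)).
Proof. by elim: k => [|k IHk]; rewrite ?conjg1 // expgSr conjgM IHk delta_sigma. Qed.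

(** sigma shifts the standard basis cyclically. *)
Lemma order_sigma : #[sigma r p] = d.
Proof.
apply/eqP; rewrite eqn_dvd order_dvdn; apply/andP; split.
  apply/eqP/linear_part_fix_basis=> [|i].
    by rewrite groupX ?mem_morphim ?inE.
  rewrite delta_sigmaX; congr (transl (e _)); apply: val_inj.
  by rewrite val_iter_ordS modnDr modn_small.
have := delta_sigmaX ord0 #[sigma r p]; rewrite expg_order conjg1 => /transl_inj.
move/rowP/(_ ord0); rewrite !mxE !eqxx /=; case: eqP => [e0 _ | _ /eqP]; last by rewrite oner_eq0.
by rewrite /dvdn -[X in X %% _]add0n -(val_iter_ordS (@ord0 r.-1)) -e0.
Qed.

Lemma S_gen_phi i : phi p i \in S.
Proof. by apply: mem_gen; apply: imset_f. Qed.

Hypotheses (p_prime : prime p) (p_odd : odd p).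

Lemma two_neq0 : (2%:R != 0 :> 'F_p)%R.
Proof.
rewrite -(dvdn_pcharf (pchar_Fp p_prime)) dvdn_prime2 //.
by apply: contraL p_odd => /eqP->.
Qed.

(** Irreducibility of the translation group under S and sigma: if v has a nonzero
    i-th coordinate then v - v phi_i is twice that coordinate times e_i, so a
    stable subgroup containing v contains e_i because 2 is invertible, and then
    the whole basis by cyclic shifts. Multiples by scalars are powers, the field
    being prime. *)
Lemma Ngrp_sub_normalised (H : {group AGL r p}) (v : V) :
    S \subset 'N(H) -> sigma r p \in 'N(H) -> v != 0%R -> transl v \in H ->
  N \subset H.
Proof.
move=> nHS nHs /rV0Pn[i vi] Hv.
have HZ a u : transl u \in H -> transl (a *: u : V)%R \in H.
  move=> Hu; rewrite -[a]natr_Zp scaler_nat translMn; exact: groupX.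
have Hi : transl (e i) \in H.
  have Hw : transl (v - v *m phi_mx p i)%R \in H.
    rewrite translD translN -[phi_mx p i]/(val (phiGL p i)) -transl_conj groupM ?groupV // memJ_norm //.
    exact: subsetP nHS _ (S_gen_phi i).
  have -> : e i = ((2%:R * v 0 i)^-1 *: (v - v *m phi_mx p i))%R.
    apply/rowP=> j; rewrite [RHS]mxE [X in (_ * X)%R]mxE [X in (_ + X)%R]mxE mul_phi_mx !mxE eqxx.
    case: (eqVneq j i) => [-> | _].
      rewrite opprK -mulr2n -[(v 0 i *+ 2)%R]mulr_natl mulVf // mulf_neq0 ?two_neq0 //.
    by rewrite subrr mulr0.
  exact: HZ.
have Hj j : transl (e j) \in H.
  (* Adding d keeps the subtraction from being truncated. *)
  have -> : j = iter (j + d - i)%N (@ordS d) i.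
    apply: val_inj; rewrite val_iter_ordS subnKC; first by rewrite modnDr modn_small.
    by rewrite (leq_trans (ltnW (ltn_ord i))) ?leq_addl.
  by rewrite -delta_sigmaX memJ_norm ?groupX.
apply/subsetP=> _ /NgrpP[u ->]; rewrite (row_sum_delta u).
elim/big_ind: _ => [||j _]; rewrite ?transl0 ?group1 //; last exact: HZ.
by move=> x y Hx Hy; rewrite translD groupM.
Qed.

End AffineGroup.

(** * The group Ggrp and its minimum normal subgroup *)

Section Ggrp.

Variables r p : nat.
Local Notation d := r.-1.+1.
Local Notation N := (Ngrp r p).
Local Notation S := (Sgrp r p).
Local Notation G := (Ggrp r p).
Local Notation sigma := (sigma r p).
Local Notation n := (transl (delta_mx 0%R ord_max : 'rV['F_p]_d)%R).
Local Notation g := (gelt r p).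

Lemma Ngrp_normal : N <| G.
Proof.
have [nsN _ _ _ _] := sdprod_context (sdprod_sdpair ('MR (GLrepr 'F_p r.-1))%gact).
by apply: (normalS _ _ nsN); rewrite ?subsetT ?(subset_trans (joing_subl _ _) (joing_subl _ _)).
Qed.

Lemma NSgrp_sdprod : N ><| S = N <*> S.
Proof. by have [[A _ defA _] _ _ _] := sdprodP (GgrpE r p); rewrite defA (sdprodWY defA). Qed.

Lemma Ggrp_sdprod : N <*> S ><| <[sigma]> = G.
Proof. by rewrite -NSgrp_sdprod GgrpE. Qed.

Lemma Ngrp_Sgrp_TI : N :&: S = 1.
Proof. by have [] := sdprod_context (K := N) (G := (N <*> S)%G) NSgrp_sdprod. Qed.

Lemma NSgrp_normal : N <*> S <| G.
Proof. by have [] := sdprod_context (K := (N <*> S)%G) Ggrp_sdprod. Qed.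

Lemma index_NSgrp : #|G : N <*> S| = d.
Proof. by rewrite -(index_sdprod Ggrp_sdprod) -orderE order_sigma. Qed.

Lemma sub_Sgrp_Ggrp : S \subset G.
Proof. exact: subset_trans (joing_subr _ _) (normal_sub NSgrp_normal). Qed.

Lemma sigma_in_Ggrp : sigma \in G.
Proof. by rewrite -cycle_subG; apply: joing_subr. Qed.

Lemma sigma_norm_Sgrp : sigma \in 'N(S).
Proof.
apply: (subsetP (norms_gen _)) (cycle_id sigma).
rewrite cycle_subG inE; apply/subsetP=> _ /imsetP[_ /imsetP[i _ ->] ->].
by rewrite phi_sigma imset_f.
Qed.

Lemma n_in_Ngrp : n \in N.
Proof. by apply/NgrpP; exists (delta_mx 0%R ord_max)%R. Qed.

(** gelt = n sigma and n lies in N, so gelt generates the same group as sigma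
    modulo N S. *)
Lemma Ggrp_mul_gelt : N <*> S * <[g]> = G.
Proof.
have [sKG nKG] := andP NSgrp_normal.
have Gg : g \in G by case/setDP: (gelt_in r p).
have Kn : n \in N <*> S by rewrite (subsetP (joing_subl _ _)) ?n_in_Ngrp.
apply/eqP; rewrite eqEsubset mul_subG ?cycle_subG //=.
rewrite -norm_joinEr ?cycle_subG ?(subsetP nKG) //.
rewrite -{1}(sdprodWY Ggrp_sdprod) join_subG joing_subl cycle_subG.
have -> : sigma = n^-1 * g by rewrite mulKg.
by rewrite groupM ?groupV ?mem_gen // inE ?Kn ?cycle_id ?orbT.
Qed.

Hypotheses (p_prime : prime p) (p_odd : odd p).

Lemma delta_neq0 i : delta_mx 0%R i != 0%R :> 'rV['F_p]_d.
Proof. by apply/eqP=> /rowP/(_ i)/eqP; rewrite !mxE !eqxx oner_eq0. Qed.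

Lemma Ngrp_neq1 : N :!=: 1.
Proof.
apply/trivgPn; exists n; first exact: n_in_Ngrp.
by rewrite -(transl0 r p) (inj_eq (@transl_inj r p)) delta_neq0.
Qed.

(** A normal subgroup M disjoint from N centralises N, so it is contained in N,
    which is self-centralising: M is trivial. Otherwise M contains a nontrivial
    translation, hence N by irreducibility. *)
Lemma Ngrp_minimum (M : {group AGL r p}) : M <| G -> M :!=: 1 -> N \subset M.
Proof.
move=> nsM ntM; have [sMG nMG] := andP nsM; have [sNG nNG] := andP Ngrp_normal.
have [x /setIP[Mx /NgrpP[v xv]] ntx] : exists2 x, x \in M :&: N & x != 1.
  apply/trivgPn; apply: contra ntM => /eqP tiMN.
  rewrite -subG1 -tiMN subsetI subxx /=; apply: subset_trans (Ngrp_selfcent r p).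
  (* Both M and N are normal, so their commutators lie in M :&: N. *)
  apply/commG1P/trivgP; rewrite -tiMN commg_subI //.
    by rewrite subsetI subxx (subset_trans sMG).
  by rewrite subsetI subxx (subset_trans sNG).
apply: (Ngrp_sub_normalised p_prime p_odd (v := v)).
- exact: subset_trans sub_Sgrp_Ggrp nMG.
- exact: subsetP nMG _ sigma_in_Ggrp.
- by apply: contraNneq ntx => v0; rewrite xv v0 transl0.
by rewrite -xv.
Qed.

Lemma Ggrp_minimal_normal (M : {group AGL r p}) : minimal_normal M G <-> M = N.
Proof.
have ntN : (N <| G) && (N :!=: 1) by rewrite Ngrp_normal Ngrp_neq1.
split=> [/mingroupP[/andP[nsM ntM] minM] | ->].
  by apply/val_inj/esym/minM => //; apply: Ngrp_minimum.
apply/mingroupP; split=> // H /andP[nsH ntH] sHN.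
by apply/eqP; rewrite eqEsubset sHN Ngrp_minimum.
Qed.

Lemma n_phi : n ^ phi p ord_max = n^-1.
Proof. by rewrite delta_phi eqxx. Qed.

(** Since the last sign change inverts n, both n sigma and n^-1 sigma belong to
    the double coset of gelt; their quotient n^2 generates the same group
    as n, of odd order p. So S and gelt generate n, sigma, and finally N. *)
Lemma Sgrp_gelt_gen : <<S :|: [set g]>> = G.
Proof.
have Gg : g \in G by case/setDP: (gelt_in r p).
apply/eqP; rewrite eqEsubset gen_subG subUset sub_Sgrp_Ggrp sub1set Gg andTb.
pose H := <<S :|: [set g]>>%G; suff: G \subset H by [].
have sSH : S \subset H by apply: sub_gen; apply: subsetUl.
have Hg : g \in H by rewrite mem_gen // !inE eqxx orbT.
have Hphi i : phi p i \in H by rewrite (subsetP sSH) ?S_gen_phi.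
have Hn2 : n ^+ 2 \in H.
  (* n^-1 sigma as an element of S gelt S: the last sign change inverts n,
     and sigma conjugates it to the first one. *)
  have e : (phi p ord_max)^-1 * g * phi p (ordS ord_max) = n^-1 * sigma.
    by rewrite -phi_sigma -n_phi !conjgE /gelt !mulgA mulgK.
  have -> : n ^+ 2 = g * ((phi p ord_max)^-1 * g * phi p (ordS ord_max))^-1.
    by rewrite e invMg invgK /gelt expgS expg1 !mulgA mulgK.
  by rewrite groupM // groupV groupM // groupM // groupV.
have Hn : n \in H.
  have np1 : n ^+ p = 1.
    by rewrite -translMn -[(_ *+ p)%R]scaler_nat (pcharf0 (pchar_Fp p_prime)) scale0r transl0.
  (* (p + 1) / 2 is the inverse of 2 modulo the order p of n. *)
  have -> : n = (n ^+ 2) ^+ (p./2.+1); last exact: groupX.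
  rewrite -expgM mul2n doubleS -[p./2.*2.+2]/((true + p./2.*2).+1) -{1}p_odd.
  by rewrite odd_double_half expgS np1 mulg1.
have Hs : sigma \in H by rewrite -(groupMl _ Hn).
have sNH : N \subset H.
  apply: (Ngrp_sub_normalised p_prime p_odd _ _ (delta_neq0 ord_max) Hn).
    exact: subset_trans (normG _).
  exact: subsetP (normG _) _ Hs.
by rewrite -(sdprodWY Ggrp_sdprod) !join_subG sNH sSH cycle_subG.
Qed.

(** If s and its conjugate by n^-1 are both in S, then the commutator of s and n
    is in N :&: S, which is trivial. *)
Lemma Sgrp_conj_n : S :&: S :^ n = 'C_S[n].
Proof.
have nNS : S \subset 'N(N) := subset_trans sub_Sgrp_Ggrp (normal_norm Ngrp_normal).
apply/setP=> s; apply/setIP/setIP=> -[Ss]; last first.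
  by move/cent1P=> cns; rewrite mem_conjg conjgE invgK mulgA -cns mulgK.
rewrite mem_conjg => Ssn; split=> //; apply/cent1P.
have : s^-1 * s ^ n^-1 \in N :&: S.
  apply/setIP; split; last by rewrite groupM ?groupV.
  have -> : s^-1 * s ^ n^-1 = n ^ s * n^-1 by rewrite !conjgE invgK !mulgA.
  by rewrite groupM ?groupV ?memJ_norm ?(subsetP nNS) ?n_in_Ngrp.
rewrite Ngrp_Sgrp_TI => /set1P/(canRL (mulKVg _)); rewrite mulg1 conjgE invgK => e.
by red; rewrite -{1}e -!mulgA mulVg mulg1.
Qed.

Lemma class_n_Sgrp : n ^: S = [set n; n^-1].
Proof.
have nAS : S \subset 'N([set n; n^-1]).
  rewrite gen_subG; apply/subsetP=> _ /imsetP[i _ ->]; rewrite inE.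
  rewrite conjUg !conjg_set1 conjVg delta_phi subUset !sub1set !inE.
  by case: ifP; rewrite ?invgK !eqxx ?orbT.
apply/eqP; rewrite eqEsubset; apply/andP; split.
  apply/subsetP=> _ /imsetP[s Ss ->].
  by rewrite memJ_norm ?(subsetP nAS) // !inE eqxx.
by rewrite subUset !sub1set class_refl -n_phi memJ_class ?S_gen_phi.
Qed.

(** sigma normalises S, so S :^ gelt = (S :^ n) :^ sigma and the index is that of
    the centraliser of n in S. The S-conjugates of n are n and its inverse, which
    differ as p is odd. *)
Lemma index_Sgrp_conj : #|S : S :&: S :^ g| = 2.
Proof.
have -> : S :&: S :^ g = (S :&: S :^ n) :^ sigma.
  by rewrite conjIg (normP sigma_norm_Sgrp) -conjsgM.
have := indexJg S (S :&: S :^ n) sigma; rewrite (normP sigma_norm_Sgrp) => ->.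
rewrite [gval (_ :&: _)]/= Sgrp_conj_n index_cent1 class_n_Sgrp.
rewrite cards2 eq_sym eq_invg_mul; case: eqP => // n2.
have /transl_inj/rowP/(_ ord_max)/eqP :
    transl (delta_mx 0 ord_max *+ 2 : 'rV['F_p]_d)%R = transl 0%R.
  by rewrite translMn transl0.
by rewrite !mxE !eqxx (negPf (two_neq0 p_prime p_odd)).
Qed.

End Ggrp.

Theorem lemma7p8 (r p : nat) (r_gt2 : (2 < r)%N) (p_prime : prime p)
    (p_odd : odd p) (p_ndvd : ~~ (p %| r - 2)%N) :
  [/\ OG4 (Ggrp r p) ('Rs)%act (Gamma r p),
      basic_oriented_cycle_type (Ggrp r p) ('Rs)%act (Gamma r p),
      (forall M : {group AGL r p},
         minimal_normal M (Ggrp r p) <-> M = Ngrp r p),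
      (Ngrp r p \isog [set: 'rV['F_p]_r])%g
    & graph_iso (normal_quotient ('Rs)%act (Gamma r p) (Ngrp r p))
                (cycle_graph r)].
Proof.
have eq_d : r.-1.+1 = r by rewrite prednK ?(ltn_trans _ r_gt2).
have idx_gt2 : (2 < #|Ggrp r p : Ngrp r p <*> Sgrp r p|)%N by rewrite index_NSgrp eq_d.
have nsN := Ngrp_normal r p.
have og4 : OG4 (Ggrp r p) ('Rs)%act (Gamma r p).
  apply: (@coset_graph_OG4 _ _ _ (Ngrp r p)).
  - exact: sub_Sgrp_Ggrp.
  - exact: nsN.
  - exact: Ngrp_neq1.
  - exact: Ngrp_Sgrp_TI.
  - exact: Ngrp_minimum.
  - exact: NSgrp_normal.
  - exact: Ggrp_mul_gelt.
  - exact: idx_gt2.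
  - exact: Sgrp_gelt_gen.
  exact: index_Sgrp_conj.
split=> //.
- apply: (@coset_graph_basic_oriented_cycle_type _ _ _ (Ngrp r p)) => //.
  - exact: sub_Sgrp_Ggrp.
  - exact: Ngrp_minimum.
  - exact: NSgrp_normal.
  exact: Ggrp_mul_gelt.
- exact: Ggrp_minimal_normal.
- case: r r_gt2 {p_ndvd eq_d idx_gt2 nsN og4} => // r' _.
  by rewrite isog_sym; apply: sub_isog (subsetT _) (injm_sdpair1 _).
have [nsL defL GL] := join_overgroup (gelt_in r p) (sub_Sgrp_Ggrp r p)
  (NSgrp_normal r p) (Ggrp_mul_gelt r p) nsN (subxx _).
have := coset_graph_quotient_cycle (L := (Ngrp r p <*> Sgrp r p)%G)
  (gelt_in r p) (sub_Sgrp_Ggrp r p) nsL nsN defL GL.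
have -> : #|Ggrp r p : (Ngrp r p <*> Sgrp r p)%G| = r by rewrite index_NSgrp eq_d.
by [].
Qed.
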